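(* Let $\tau\in\mathcal S_0$. Let $(\mathcal Q,d)$ be a metric space and $y,z,q,p\in\mathcal Q$. Assume $$d(y,q)^2-d(y,p)^2-d(z,q)^2+d(z,p)^2\le 2\,d(q,p)\,d(y,z).$$ Write $A:=d(q,p)$ and $B:=d(y,z)$. Then the value $$\tau(d(y,q))-\tau(d(y,p))-\tau(d(z,q))+\tau(d(z,p))$$ is bounded from above by all of the following values: (i) $2\min(A,B)\,\tau'(\max(A,B))$; (ii) $2A^{\beta}B^{1-\beta}\,\tau'(A^{1-\beta}B^{\beta})$ for all $\beta\in[0,1]$; (iii) $2(\beta A+(1-\beta)B)\,\tau'((1-\beta)A+\beta B)$ for all $\beta\in[0,1]$; (iv) $2\sqrt{AB}\,\tau'(\sqrt{AB})$; (v) $(A+B)\,\tau'\!\left(\frac{A+B}{2}\right)$; (vi) $4\,\tau(\sqrt{AB})$; (vii) $4\,\tau\!\left(\frac{A+B}{2}\right)$; (viii) $2\tau(A)+2\tau(B)$.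
   Context: $\mathcal S$ is the set of nondecreasing, convex functions $\tau\colon[0,\infty)\to\mathbb R$ that are differentiable on $(0,\infty)$ with concave derivative $\tau'$; $\tau'$ is extended to $0$ by $\tau'(0):=\lim_{x\searrow0}\tau'(x)$. $\mathcal S_0:=\{\tau\in\mathcal S:\tau(0)=0\}$. *)

(* Defs.v *)
From mathcomp Require Import all_boot all_order all_algebra.
From mathcomp Require Import all_classical all_reals all_analysis.
Import Order.TTheory GRing.Theory Num.Theory.
Import numFieldNormedType.Exports.

Set Implicit Arguments.
Unset Strict Implicit.
Unset Printing Implicit Defensive.

Local Open Scope classical_set_scope.
Local Open Scope ring_scope.

Definition concave_function (R : realType) (D : set R) (f : R -> R) : Prop :=
  convex_function D (fun x => - f x).

(* Functions on [0, +oo[ are total functions R -> R whose values at negative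
   arguments are unconstrained: every condition is relative to [0, +oo[ or to
   the open half-line ]0, +oo[, on which the derivative is local. *)
Definition transforms (R : realType) : set (R -> R) :=
  [set tau : R -> R |
    [/\ {in `[0, +oo[ &, nondecreasing_fun tau},
        convex_function (`[0, +oo[%classic : set R) tau,
        {in `]0, +oo[, forall x, derivable tau x 1} &
        concave_function `]0, +oo[ (derive1 tau)]].

Definition transforms0 (R : realType) : set (R -> R) :=
  [set tau : R -> R | transforms tau /\ tau 0 = 0].

(* For tau in [transforms], the derivative is nonnegative and nondecreasing on
   ]0, +oo[, so the right limit at 0 exists in R and [lim] is not a default
   value. *)
Definition derive1_ext0 (R : realType) (tau : R -> R) (x : R) : R :=
  if x == 0 then lim (derive1 tau t @[t --> 0^'+]) else derive1 tau x.

(* Main.v *)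
Require Import Defs.
From mathcomp Require Import all_boot all_order all_algebra.
From mathcomp Require Import all_classical all_reals all_analysis.
From mathcomp Require Import ring lra.
Import Order.TTheory GRing.Theory Num.Theory.
Import numFieldNormedType.Exports.
Local Open Scope classical_set_scope.
Local Open Scope ring_scope.

(** All eight bounds come from one inequality, V <= 2 A tau'(B), and its mirror
    image V <= 2 B tau'(A), obtained by exchanging the pair (y, z) with the
    pair (q, p): this exchange changes neither V nor the hypothesis.

    To prove it, write a, b, c, e for d(y,q), d(y,p), d(z,q), d(z,p), so that V
    is the integral of tau' from b to a plus its integral from c to e.  Being
    concave and nonnegative, tau' lies below a line l(x) = tau'(B) + k (x - B)
    with 0 <= k <= tau'(B) / B ([supergradient]).  If a >= b and e >= c, replace
    tau' by l in both integrals.  The constant part l(0) = tau'(B) - k B >= 0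
    contributes at most 2 A l(0) by the triangle inequality, the linear part at
    most k A B by hypothesis, and the sum is at most 2 A tau'(B).  If the two
    increments have opposite signs, one of the integrals needs a lower bound
    on tau', which l does not give.  In that case the shorter interval is
    compared with a piece of the longer one of the same length; by the triangle
    inequality the two are at most B apart, and subadditivity of tau' makes the
    shift cost at most tau'(B) per unit of length
    ([transform_increment_shift]).  The rest of the longer interval is treated
    with l as before if its increment is the positive one, and dropped
    otherwise, since tau is nondecreasing.  If both increments are nonpositive,
    so is V.  This is [transform_quadruple_le].

    Since tau'(x) / x is nonincreasing, one of the two bounds gives
    V <= 2 A B tau'(n) / n for 0 < n <= max(A, B), hence V <= 2 m tau'(n) as
    soon as A B <= m n ([cross_bound_mean]).  Each bound involving tau' is an
    instance, with m and n two conjugate means of A and B.  The bounds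
    involving tau itself follow from x tau'(x) <= 2 tau(x) and convexity.  When
    A B = 0, two of the points coincide, V = 0, and every right-hand side is
    nonnegative. *)

(** * Nonnegative concave functions on the open half-line *)

Section ConcaveHalfLine.
Variables (R : realType) (f : R -> R).
Hypothesis f_ge0 : forall x : R, 0 < x -> 0 <= f x.
Hypothesis f_concave : concave_function `]0, +oo[ f.

(** Concavity without division, for the comparison of slopes on both sides of
    a point. *)
Lemma concave_three_points (x y z : R) : 0 < x -> x < y -> y < z ->
  (z - y) * f x + (y - x) * f z <= (z - x) * f y.
Proof.
move=> x0 xy yz.
have zx : 0 < z - x by lra.
have t01 : 0 <= (z - y) / (z - x) <= 1.
  by rewrite divr_ge0 ?ler_pdivrMr //; lra.
have [t0 t1] := andP t01.
pose t := Itv01 t0 t1.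
have xD : (x : R^o) \in (`]0, +oo[%classic : set R).
  by rewrite inE/= in_itv/= andbT.
have zD : (z : R^o) \in (`]0, +oo[%classic : set R).
  by rewrite inE/= in_itv/= andbT; lra.
have : - f ((z - y) / (z - x) * x + (1 - (z - y) / (z - x)) * z) <=
  (z - y) / (z - x) * - f x + (1 - (z - y) / (z - x)) * - f z.
  exact: f_concave t x z xD zD.
have -> : (z - y) / (z - x) * x + (1 - (z - y) / (z - x)) * z = y.
  by field; lra.
rewrite -(ler_pM2l zx).
have -> : (z - x) * ((z - y) / (z - x) * - f x
    + (1 - (z - y) / (z - x)) * - f z) = - ((z - y) * f x + (y - x) * f z).
  by field; lra.
by rewrite mulrN lerN2.
Qed.

(** The slope [k] is the supremum of the slopes of the chords to the right of
    [x], which the slopes of the chords to the left bound from above.  A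
    negative [k] would bring [f] below 0 far to the right, and [k * x > f x]
    would bring it below 0 close to the origin. *)
Lemma supergradient (x : R) : 0 < x -> exists k,
  [/\ 0 <= k, k * x <= f x & forall y, 0 < y -> f y <= f x + k * (y - x)].
Proof.
move=> x0.
pose S := [set (f z - f x) / (z - x) | z in `]x, +oo[].
have S0 : S !=set0.
  exists ((f (x + 1) - f x) / (x + 1 - x)), (x + 1) => //=.
  by rewrite in_itv/= andbT; lra.
have Sub y : 0 < y -> y < x -> ubound S ((f x - f y) / (x - y)).
  move=> y0 yx r [z /=]; rewrite in_itv/= andbT => xz <- {r}.
  rewrite ler_pdivrMr ?subr_gt0// mulrAC ler_pdivlMr ?subr_gt0//.
  have := concave_three_points _ _ _ y0 yx xz; lra.
have hS : has_sup S.
  by split=> //; exists ((f x - f (x / 2)) / (x - x / 2)); apply: Sub; lra.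
pose k := sup S.
have kr z : x < z -> f z - f x <= k * (z - x).
  move=> xz; rewrite -ler_pdivrMr ?subr_gt0//.
  apply: ub_le_sup; first by case: hS.
  by exists z => //=; rewrite in_itv/= andbT.
have kl y : 0 < y -> y < x -> k * (x - y) <= f x - f y.
  move=> y0 yx; rewrite -ler_pdivlMr ?subr_gt0//.
  by apply: ge_sup => //; apply: Sub.
have fx := f_ge0 _ x0.
have k0 : 0 <= k.
  rewrite leNgt; apply/negP => k0.
  (* At this distance from x the line of slope k through (x, f x) has
     descended to the value -1. *)
  have d0 : 0 < (f x + 1) / - k by rewrite divr_gt0; lra.
  have := kr (x + (f x + 1) / - k).
  have := f_ge0 (x + (f x + 1) / - k).
  have -> : k * (x + (f x + 1) / - k - x) = - (f x + 1) by field; lra.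
  by lra.
exists k; split=> //.
  rewrite leNgt; apply/negP => kx.
  have k1 : 0 < k.
    by rewrite lt_neqAle k0 andbT; apply/eqP => k1; move: kx; rewrite -k1; lra.
  (* The line of slope k through (x, f x) is negative at this y, halfway
     between the origin and its zero. *)
  pose y := (x - f x / k) / 2.
  have ky : k * y = (k * x - f x) / 2 by rewrite /y; field; lra.
  have y0 : 0 < y by rewrite -(pmulr_rgt0 _ k1) ky; lra.
  have yx : y < x by rewrite -(ltr_pM2l k1) ky; lra.
  have := kl y y0 yx; have := f_ge0 _ y0; lra.
move=> y y0; have [yx|xy|->] := ltgtP y x; last lra.
  by have := kl y y0 yx; lra.
by have := kr y xy; lra.
Qed.

(** The supporting line at the right endpoint has slope at least 0. *)
Lemma concave_ge0_homo (x y : R) : 0 < x -> x <= y -> f x <= f y.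
Proof.
move=> x0 xy; have y0 : 0 < y by lra.
have [k [k0 _ /(_ x x0)]] := supergradient y y0.
have : k * (x - y) <= 0 by nra.
lra.
Qed.

(** That is, [f x / x] is nonincreasing: the supporting line at [x] has a
    nonnegative value at 0. *)
Lemma concave_ge0_star (x y : R) : 0 < x -> x <= y -> x * f y <= y * f x.
Proof.
move=> x0 xy; have y0 : 0 < y by lra.
have [k [k0 kx /(_ y y0)]] := supergradient x x0.
nra.
Qed.

Lemma concave_ge0_subadditive (x y : R) : 0 < x -> 0 < y ->
  f (x + y) <= f x + f y.
Proof.
move=> x0 y0.
have xs := concave_ge0_star x (x + y) x0.
have ys := concave_ge0_star y (x + y) y0.
rewrite -(@ler_pM2l _ (x + y)); lra.
Qed.

End ConcaveHalfLine.

(** * Comparing increments through derivatives *)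

Section Increments.
Variable R : realType.

(** Right continuity at 0 replaces differentiability there, because the
    functions to be compared need not be differentiable, or even controlled,
    to the left of 0. *)
Lemma increment_le (F G F' G' : R -> R) (M : R) :
  (forall t : R, 0 < t -> is_derive t 1 F (F' t)) ->
  (forall t : R, 0 < t -> is_derive t 1 G (G' t)) ->
  F t @[t --> 0^'+] --> F 0 -> G t @[t --> 0^'+] --> G 0 ->
  (forall t : R, 0 < t -> t < M -> F' t <= G' t) ->
  0 <= M -> F M - F 0 <= G M - G 0.
Proof.
move=> dF dG cF cG FG M0.
pose H (t : R) := G t - F t.
have dH (t : R) : 0 < t -> is_derive t 1 H (G' t - F' t).
  by move=> t0; have := dF t t0; have := dG t t0; exact: is_deriveB.
suff : H 0 <= H M by rewrite /H; lra.
have [->//|M1] := eqVneq M 0.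
have MM : 0 < M by rewrite lt_neqAle eq_sym M1.
apply: (@ger0_derive1_ndecr _ H 0 M) => //.
- by move=> t; rewrite in_itv/= => /andP[t0 _]; have := dH t t0; case.
- move=> t; rewrite in_itv/= => /andP[t0 tM]; have Ht := dH t t0.
  by rewrite derive1E derive_val subr_ge0; exact: FG.
- apply/continuous_within_itvP => //; split.
  + move=> t; rewrite in_itv/= => /andP[t0 _]; apply: differentiable_continuous.
    by apply/derivable1_diffP; case: (dH t t0).
  + by apply: cvgB.
  + apply: cvg_at_left_filter; apply: differentiable_continuous.
    by apply/derivable1_diffP; case: (dH M MM).
Qed.

Lemma is_derive_quadratic (m k t : R) :
  is_derive t 1 (fun s => m * s + k / 2 * s ^+ 2) (m + k * t).
Proof. by apply: is_derive_eq; rewrite /GRing.scale /=; field. Qed.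

Lemma quadratic_cvg (m k : R) :
  m * t + k / 2 * t ^+ 2 @[t --> 0^'+] --> m * 0 + k / 2 * 0 ^+ 2.
Proof.
have : {for 0, continuous (fun t : R => m * t + k / 2 * t ^+ 2)}.
  apply: differentiable_continuous.
  by apply/derivable1_diffP; case: (is_derive_quadratic m k 0).
exact: cvg_at_right_filter.
Qed.

End Increments.

(** * Transforms and their derivatives *)

Section Transform.
Variables (R : realType) (tau : R -> R).
Hypothesis htau : transforms tau.
Local Notation phi := (derive1 tau).

Lemma transform_homo (x y : R) : 0 <= x -> x <= y -> tau x <= tau y.
Proof.
move=> x0 xy; case: htau => + _ _ _; apply => //; rewrite in_itv/= andbT; lra.
Qed.

Lemma transform_convex (x y t : R) : 0 <= x -> 0 <= y -> 0 <= t <= 1 ->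
  tau (t * x + (1 - t) * y) <= t * tau x + (1 - t) * tau y.
Proof.
move=> x0 y0 /andP[t0 t1]; case: htau => _ tauC _ _.
have xD : (x : R^o) \in (`[0, +oo[%classic : set R).
  by rewrite inE/= in_itv/= andbT.
have yD : (y : R^o) \in (`[0, +oo[%classic : set R).
  by rewrite inE/= in_itv/= andbT.
exact: tauC (Itv01 t0 t1) x y xD yD.
Qed.

Lemma transform_is_derive (x : R) : 0 < x -> is_derive x 1 tau (phi x).
Proof.
move=> x0; rewrite derive1E; apply/derivableP.
by case: htau => _ _ + _; apply; rewrite in_itv/= andbT.
Qed.

Lemma transform_derive_concave : concave_function `]0, +oo[ phi.
Proof. by case: htau. Qed.

(** Adding a small linear term [e * u] to [tau] makes it strictly increasing,
    so that its derivative [e + phi x] is nonnegative for every [e > 0]. *)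
Lemma transform_derive_ge0 (x : R) : 0 < x -> 0 <= phi x.
Proof.
move=> x0; apply/ler_addgt0Pl => e e0.
have tau_e_derive (t : R) : 0 < t ->
    is_derive t 1 (fun u : R => e * u + tau u) (e + phi t).
  move=> t0; have dt := transform_is_derive t t0.
  apply: is_derive_eq.
  by rewrite /GRing.scale /=; ring.
have := @incr_derive1_ge0_itvy _ (fun u : R => e * u + tau u) false 0 x.
have dx := tau_e_derive x x0.
rewrite derive1E derive_val; apply.
- by move=> t; rewrite inE/= in_itv/= andbT => t0; case: (tau_e_derive t t0).
- move=> t u; rewrite !in_itv/= !andbT => t0 u0 tu.
  have := transform_homo t u; have : e * t < e * u by rewrite ltr_pM2l.
  by lra.
- by rewrite in_itv/= andbT.
Qed.

Lemma transform_derive_homo (x y : R) : 0 < x -> x <= y -> phi x <= phi y.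
Proof.
exact: concave_ge0_homo transform_derive_ge0 transform_derive_concave x y.
Qed.

Lemma transform_derive_star (x y : R) : 0 < x -> x <= y ->
  x * phi y <= y * phi x.
Proof.
exact: concave_ge0_star transform_derive_ge0 transform_derive_concave x y.
Qed.

Lemma transform_derive_subadditive (x y : R) : 0 < x -> 0 < y ->
  phi (x + y) <= phi x + phi y.
Proof.
exact: concave_ge0_subadditive transform_derive_ge0
  transform_derive_concave x y.
Qed.

(** For [t] in ]0, 1[, monotonicity and the chord from [x] to [x + 1] squeeze
    [tau (x + t)] between [tau x] and an affine function of [t]; this covers
    [x = 0], where differentiability says nothing. *)
Lemma transform_shift_cvg (x : R) : 0 <= x ->
  tau (x + t) @[t --> 0^'+] --> tau (x + 0).
Proof.
move=> x0; rewrite addr0.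
apply: (@squeeze_cvgr _ _ _ _ (fun=> tau x)
  (fun t => tau x + t * (tau (x + 1) - tau x))).
- near=> t.
  have t0 : 0 < t by near: t; exact: nbhs_right_gt.
  have t1 : t < 1 by near: t; apply: nbhs_right_lt.
  apply/andP; split; first by apply: transform_homo; lra.
  have := @transform_convex (x + 1) x t.
  have -> : t * (x + 1) + (1 - t) * x = x + t by ring.
  have -> : 0 <= t <= 1 by lra.
  move=> /(_ _ x0 isT); lra.
- exact: cvg_cst.
- have : tau x + t * (tau (x + 1) - tau x) @[t --> 0^'+]
      --> tau x + 0 * (tau (x + 1) - tau x).
    apply: cvgD; first exact: cvg_cst.
    apply: cvgMr_tmp; apply: cvg_at_right_filter; exact: cvg_id.
  by rewrite mul0r addr0.
Unshelve. all: by end_near. Qed.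

Lemma transform_shift_derive (x t : R) : 0 <= x -> 0 < t ->
  is_derive t 1 (fun t => tau (x + t)) (phi (x + t)).
Proof.
move=> x0 t0.
have d : is_derive (x + t) 1 tau (phi (x + t)).
  by apply: transform_is_derive; lra.
have := @is_derive1_comp _ tau (fun t => x + t) t (phi (x + t)) 1 d.
rewrite mulr1; apply.
rewrite -[X in is_derive _ _ _ X]add0r.
exact: is_deriveD.
Qed.

Lemma transform_increment_homo (x y t : R) : 0 <= x -> x <= y -> 0 <= t ->
  tau (x + t) - tau x <= tau (y + t) - tau y.
Proof.
move=> x0 xy t0; have y0 : 0 <= y by lra.
rewrite -[X in _ - tau X <= _]addr0 -[X in _ <= _ - tau X]addr0.
apply: (@increment_le _ (fun s => tau (x + s)) (fun s => tau (y + s))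
  (fun s => phi (x + s)) (fun s => phi (y + s)));
  rewrite //; do ?exact: transform_shift_cvg.
- by move=> s s0; exact: transform_shift_derive.
- by move=> s s0; exact: transform_shift_derive.
- by move=> s s0 _; apply: transform_derive_homo; lra.
Qed.

(** Moving an interval of length [t] to the right by [d <= B] raises the
    derivative by at most [phi B] at each point, by subadditivity. *)
Lemma transform_increment_shift (x d B t : R) :
  0 <= x -> 0 <= d -> d <= B -> 0 < B -> 0 <= t ->
  tau (x + d + t) - tau (x + d) <= tau (x + t) - tau x + t * phi B.
Proof.
move=> x0 d0 dB B0 t0.
apply: (@le_trans _ _ (tau (x + B + t) - tau (x + B))).
  by apply: transform_increment_homo; lra.
have := @increment_le _ (fun s => tau (x + B + s))
  (fun s => tau (x + s) + (phi B * s + 0 / 2 * s ^+ 2))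
  (fun s => phi (x + B + s)) (fun s => phi (x + s) + (phi B + 0 * s)) t.
rewrite /= !addr0 => H.
apply: le_trans (H _ _ _ _ _ t0) _; last lra.
- by move=> s s0; apply: transform_shift_derive => //; lra.
- move=> s s0; apply: is_deriveD; last exact: is_derive_quadratic.
  exact: transform_shift_derive.
- by have := @transform_shift_cvg (x + B); rewrite addr0; apply; lra.
- apply: cvgD; last exact: quadratic_cvg.
  by have := @transform_shift_cvg x; rewrite addr0; apply.
- move=> s s0 _; rewrite mul0r addr0 addrAC.
  by apply: transform_derive_subadditive => //; lra.
Qed.

(** The right-hand side is the integral over [b, a] of the line that bounds
    [phi] from above. *)
Lemma transform_increment_tangent (m k B b a : R) :
  (forall y : R, 0 < y -> phi y <= m + k * (y - B)) ->
  0 <= b -> b <= a ->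
  tau a - tau b <= (m - k * B) * (a - b) + k * (a ^+ 2 - b ^+ 2) / 2.
Proof.
move=> tang b0 ba.
have := @increment_le _ (fun s => tau (b + s))
  (fun s => (m - k * B + k * b) * s + k / 2 * s ^+ 2)
  (fun s => phi (b + s)) (fun s => (m - k * B + k * b) + k * s) (a - b).
rewrite /= addr0 subrKC => H.
have ab0 : 0 <= a - b by lra.
apply: le_trans (H _ _ _ _ _ ab0) _; last lra.
- by move=> s s0; exact: transform_shift_derive.
- by move=> s s0; exact: is_derive_quadratic.
- by have := @transform_shift_cvg b; rewrite addr0; apply.
- exact: quadratic_cvg.
- by move=> s s0 _; have := tang (b + s); lra.
Qed.

(** On ]0, x[ the derivative is at least [s * (phi x / x)], whose integral is
    [x * phi x / 2]. *)
Lemma transform_derive_le_double (x : R) : 0 < x ->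
  x * phi x <= 2 * (tau x - tau 0).
Proof.
move=> x0.
have : (0 * x + phi x / x / 2 * x ^+ 2) - (0 * 0 + phi x / x / 2 * 0 ^+ 2)
    <= tau (0 + x) - tau (0 + 0).
  apply: (@increment_le _ (fun s => 0 * s + phi x / x / 2 * s ^+ 2)
    (fun s => tau (0 + s))
    (fun s => 0 + phi x / x * s) (fun s => phi (0 + s)) x).
  - by move=> s s0; exact: is_derive_quadratic.
  - by move=> s s0; exact: transform_shift_derive.
  - exact: quadratic_cvg.
  - exact: transform_shift_cvg.
  - move=> s s0 sx; rewrite !add0r mulrAC ler_pdivrMr // mulrC [leRHS]mulrC.
    by apply: transform_derive_star => //; exact: ltW.
  - exact: ltW.
have -> : 0 * x + phi x / x / 2 * x ^+ 2 = x * phi x / 2 by field; lra.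
rewrite !add0r; lra.
Qed.

(** * The quadruple inequality *)

(** The integral of [phi] from [b] to [a] plus that from [c] to [e].  The
    hypotheses are invariant under (a, b, c, e) -> (e, c, b, a), so the
    increment [a - b] may be taken to be the larger of the two. *)
Lemma transform_quadruple_le (A B a b c e : R) :
  0 <= A -> 0 < B -> 0 <= a -> 0 <= b -> 0 <= c -> 0 <= e ->
  a - b <= A -> e - c <= A -> `|a - c| <= B -> `|b - e| <= B ->
  a ^+ 2 - b ^+ 2 - c ^+ 2 + e ^+ 2 <= 2 * A * B ->
  tau a - tau b - tau c + tau e <= 2 * A * phi B.
Proof.
move=> A0 B0 + + + +.
have phiB := transform_derive_ge0 B B0.
have [k [k0 kB tang]] :=
  supergradient _ _ transform_derive_ge0 transform_derive_concave B B0.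
have steep u v := transform_increment_tangent (phi B) k B u v tang.
wlog vu : a b c e / e - c <= a - b.
  move=> wl a0 b0 c0 e0 ab ec ac be Q.
  have [|/ltW] := leP (e - c) (a - b); first by move=> ?; exact: wl.
  move=> uv; have := wl e c b a uv e0 c0 b0 a0 ec ab.
  rewrite (distrC e) (distrC c) => /(_ be ac); lra.
move=> a0 b0 c0 e0 ab ec ac be Q.
have [u_le0|u_gt0] := leP a b.
  have := transform_homo a b a0 u_le0; have := transform_homo e c e0; nra.
have [v_ge0|v_lt0] := leP c e.
  have T1 := steep b a b0 (ltW u_gt0); have T2 := steep c e c0 v_ge0.
  have : 0 <= k * (2 * A * B - (a ^+ 2 - b ^+ 2 - c ^+ 2 + e ^+ 2)).
    by rewrite mulr_ge0 // subr_ge0.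
  have : 0 <= (phi B - k * B) * (A - (a - b) + (A - (e - c))).
    by rewrite mulr_ge0; lra.
  have : 0 <= k * (A * B) by rewrite !mulr_ge0 // ltW.
  lra.
move: ac be; rewrite !ler_norml => /andP[ac1 ac2] /andP[be1 be2].
have uphi : (a - b) * phi B <= A * phi B by rewrite ler_wpM2r.
have Aphi : 0 <= A * phi B by rewrite mulr_ge0.
(* From here on [e - c] is negative, and the interval from e to c is
   subtracted from the one from b to a. *)
have u0 : 0 < a - b by lra.
have [uw|wu] := leP (a - b) (c - e).
  (* Keep only the initial part of [e, c], of the length of [b, a]. *)
  have : tau (e + (a - b)) <= tau c by apply: transform_homo; lra.
  have [be0|eb0] := leP e b.
    have be0' : 0 <= b - e by lra.
    have :=
      transform_increment_shift e (b - e) B (a - b) e0 be0' be2 B0 (ltW u0).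
    by rewrite !subrKC; lra.
  have := transform_increment_homo b e (a - b) b0 (ltW eb0) (ltW u0).
  by rewrite subrKC; lra.
(* Compare [e, c] with the final part [a', a] of [b, a], of the same length w,
   and use the supporting line on [b, a']. *)
pose w := c - e; pose a' := a - w.
have w0 : 0 <= w by rewrite /w; lra.
have ba' : b <= a' by rewrite /a' /w; lra.
have T1 := steep b a' b0 ba'.
have kAB : 0 <= k * (2 * A * B - (a ^+ 2 - b ^+ 2 - c ^+ 2 + e ^+ 2)).
  by rewrite mulr_ge0 // subr_ge0.
have E : 0 <= (phi B - k * B) * (A - (a' - b)).
  by rewrite mulr_ge0 // /a'; lra.
have wphi : w * phi B <= A * phi B by rewrite ler_wpM2r // /w; lra.
have [ca|ac] := leP c a.
  have ac0 : 0 <= a - c by lra.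
  have := transform_increment_shift e (a - c) B w e0 ac0 ac2 B0 w0.
  have -> : e + (a - c) = a' by rewrite /a' /w; ring.
  have -> : a' + w = a by rewrite /a'; ring.
  have -> : e + w = c by rewrite /w; ring.
  have : 0 <= k * (w * (a - c)) by rewrite !mulr_ge0 // subr_ge0.
  move: T1 kAB E wphi; rewrite /a' /w; lra.
(* Here [a', a] lies to the left of [e, c], so their difference is nonpositive
   and it is the quadratic hypothesis that loses w (c - a) <= w B. *)
have a'0 : 0 <= a' by lra.
have a'e : a' <= e by rewrite /a' /w; lra.
have := transform_increment_homo a' e w a'0 a'e w0.
have -> : a' + w = a by rewrite /a'; ring.
have -> : e + w = c by rewrite /w; ring.
have : 0 <= k * (w * (B - (c - a))) by rewrite !mulr_ge0 //; lra.
have : 0 <= w * (phi B - k * B) by rewrite !mulr_ge0 //; lra.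
move: T1 kAB E wphi; rewrite /a' /w; lra.
Qed.

Lemma derive1_ext0E (x : R) : 0 < x -> derive1_ext0 tau x = phi x.
Proof. by move=> x0; rewrite /derive1_ext0 gt_eqF. Qed.

(** At 0, monotonicity and nonnegativity of [phi] make the right limit exist. *)
Lemma derive1_ext0_ge0 (x : R) : 0 <= x -> 0 <= derive1_ext0 tau x.
Proof.
rewrite le_eqVlt => /predU1P[<-|x0]; last first.
  by rewrite derive1_ext0E // transform_derive_ge0.
rewrite /derive1_ext0 eqxx; apply: limr_ge; last first.
  near=> t; apply: transform_derive_ge0; near: t; exact: nbhs_right_gt.
apply: nondecreasing_at_right_is_cvgr; near=> t.
  move=> x1 x2; rewrite !in_itv/= => /andP[x10 _] _ x12.
  exact: transform_derive_homo.
exists 0 => r [s /=]; rewrite in_itv/= => /andP[s0 _] <- {r}.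
exact: transform_derive_ge0.
Unshelve. all: by end_near. Qed.

(** [phi n / n] is at least [phi A / A] or [phi B / B], according to which of
    [A] and [B] exceeds [n], so one of the two bounds becomes
    [V <= 2 * (A * B) * (phi n / n)]. *)
Lemma cross_bound_mean (A B V m n : R) : 0 < A -> 0 < B ->
  V <= 2 * A * phi B -> V <= 2 * B * phi A ->
  0 < n -> n <= Num.max A B -> A * B <= m * n -> V <= 2 * m * phi n.
Proof.
move=> A0 B0 VA VB n0 nM ABmn.
have nV : n * V <= 2 * (A * B) * phi n.
  move: nM; rewrite le_max => /orP[nA|nB].
    have := transform_derive_star n A n0 nA; nra.
  have := transform_derive_star n B n0 nB; nra.
rewrite -(ler_pM2l n0); apply: le_trans nV _.
have : A * B * phi n <= m * n * phi n.
  by rewrite ler_wpM2r // transform_derive_ge0.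
lra.
Qed.

Lemma transform_mdist_quadruple_le (Q : metricType R) (y z q p : Q) :
  0 < mdist y z ->
  mdist y q ^+ 2 - mdist y p ^+ 2 - mdist z q ^+ 2 + mdist z p ^+ 2
    <= 2 * mdist q p * mdist y z ->
  tau (mdist y q) - tau (mdist y p) - tau (mdist z q) + tau (mdist z p)
    <= 2 * mdist q p * phi (mdist y z).
Proof.
move=> yz0 quad.
have tri (u v w : Q) : mdist u v - mdist u w <= mdist w v.
  by have := metric_triangle u w v; lra.
have triN (u v w : Q) : `|mdist u w - mdist v w| <= mdist u v.
  rewrite ler_norml; have := metric_triangle v u w.
  have := metric_triangle u v w.
  by rewrite (metric_sym v u); lra.
apply: transform_quadruple_le; rewrite ?mdist_ge0 //.
by rewrite (metric_sym q p).
Qed.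

End Transform.

(** * Bounds through means of the two distances *)

Theorem corollary23 (R : realType) (tau : R -> R) (htau : transforms0 tau)
    (Q : metricType R) (y z q p : Q)
    (hquad : mdist y q ^+ 2 - mdist y p ^+ 2 - mdist z q ^+ 2 + mdist z p ^+ 2
             <= 2 * mdist q p * mdist y z) :
  let A := mdist q p in
  let B := mdist y z in
  let V := tau (mdist y q) - tau (mdist y p) - tau (mdist z q)
           + tau (mdist z p) in
  (V <= 2 * Num.min A B * derive1_ext0 tau (Num.max A B)) /\
  (forall beta : R, 0 <= beta <= 1 ->
     V <= 2 * (A `^ beta * B `^ (1 - beta))
          * derive1_ext0 tau (A `^ (1 - beta) * B `^ beta)) /\
  (forall beta : R, 0 <= beta <= 1 ->
     V <= 2 * (beta * A + (1 - beta) * B)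
          * derive1_ext0 tau ((1 - beta) * A + beta * B)) /\
  (V <= 2 * Num.sqrt (A * B) * derive1_ext0 tau (Num.sqrt (A * B))) /\
  (V <= (A + B) * derive1_ext0 tau ((A + B) / 2)) /\
  (V <= 4 * tau (Num.sqrt (A * B))) /\
  (V <= 4 * tau ((A + B) / 2)) /\
  (V <= 2 * tau A + 2 * tau B).
Proof.
move=> A B V; have [tauS tau00] := htau.
have A0 : 0 <= A := mdist_ge0 _ _.
have B0 : 0 <= B := mdist_ge0 _ _.
have tau_ge0 (x : R) : 0 <= x -> 0 <= tau x.
  by move=> x0; rewrite -tau00; exact: transform_homo.
have ext_ge0 := derive1_ext0_ge0 _ _ tauS.
have [AB0|AB0] := eqVneq (A * B) 0.
  have V0 : V = 0.
    have [] : q = p \/ y = z.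
    - move/eqP: AB0; rewrite mulf_eq0.
      by move=> /orP[] /eqP /mdist_positivity; [left|right].
    - by move=> qp; rewrite /V qp; ring.
    - by move=> yz; rewrite /V yz; ring.
  rewrite V0 AB0 sqrtr0.
  have hb (b : R) : 0 <= b <= 1 -> 0 <= b * A + (1 - b) * B.
    by move=> /andP[b0 b1]; rewrite addr_ge0 // mulr_ge0 //; lra.
  split; first by rewrite !mulr_ge0 ?le_min ?A0 // ext_ge0 // le_max A0.
  split=> [b _|].
    by rewrite !mulr_ge0 ?powR_ge0 // ext_ge0 // mulr_ge0 ?powR_ge0.
  split=> [b /andP[b0 b1]|].
    rewrite !mulr_ge0 ?ext_ge0 ?hb //; first by rewrite b0.
    by rewrite addr_ge0 // mulr_ge0 //; lra.
  split; first by rewrite mulr0 mul0r.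
  split; first by rewrite mulr_ge0 ?ext_ge0 //; lra.
  split; first by rewrite mulr_ge0 ?tau_ge0.
  split; first by rewrite mulr_ge0 ?tau_ge0 //; lra.
  by rewrite addr_ge0 // mulr_ge0 ?tau_ge0.
have [Agt0 Bgt0] : 0 < A /\ 0 < B.
  apply/andP; move: AB0.
  by rewrite mulf_eq0 negb_or !lt_neqAle A0 B0 ![0 == _]eq_sym !andbT.
have ABgt0 : 0 < A * B by rewrite mulr_gt0.
have VA : V <= 2 * A * derive1 tau B by exact: transform_mdist_quadruple_le.
have VB : V <= 2 * B * derive1 tau A.
  have -> : V = tau (mdist q y) - tau (mdist q z) - tau (mdist p y)
                + tau (mdist p z).
    by rewrite /V !(metric_sym q) !(metric_sym p); ring.
  apply: transform_mdist_quadruple_le => //.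
  rewrite (metric_sym q y) (metric_sym q z) (metric_sym p y) (metric_sym p z).
  by move: hquad; lra.
have mean (m n : R) : 0 < n -> n <= Num.max A B -> A * B <= m * n ->
    V <= 2 * m * derive1_ext0 tau n.
  move=> n0 nM ABmn; rewrite derive1_ext0E //.
  exact: (cross_bound_mean _ tau tauS A B).
have dbl (x : R) : 0 < x -> x * derive1 tau x <= 2 * tau x.
  move=> x0; have := transform_derive_le_double _ _ tauS x x0.
  by rewrite tau00 subr0.
have arith (b : R) : 0 <= b <= 1 ->
    V <= 2 * (b * A + (1 - b) * B) * derive1_ext0 tau ((1 - b) * A + b * B).
  move=> /andP[b0 b1]; have b1' : 0 <= 1 - b by lra.
  apply: mean.
  - have [->|bn0] := eqVneq b 0; first by lra.
    have : 0 < b * B by rewrite mulr_gt0 // lt_neqAle eq_sym bn0.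
    have : 0 <= (1 - b) * A by rewrite mulr_ge0.
    lra.
  - rewrite le_max; have [AB|BA] := leP A B.
      have : 0 <= (1 - b) * (B - A) by rewrite mulr_ge0 ?subr_ge0.
      by move=> ?; apply/orP; right; lra.
    have : 0 <= b * (A - B) by rewrite mulr_ge0 // subr_ge0 ltW.
    by move=> ?; apply/orP; left; lra.
  - (* The product of the two means exceeds A * B by this quantity. *)
    have : 0 <= b * (1 - b) * (A - B) ^+ 2.
      by apply: mulr_ge0; [exact: mulr_ge0 | exact: sqr_ge0].
    lra.
have sqrtAB := sqr_sqrtr (ltW ABgt0).
have sqrt_gt0 : 0 < Num.sqrt (A * B) by rewrite sqrtr_gt0.
have geom : V <= 2 * Num.sqrt (A * B) * derive1_ext0 tau (Num.sqrt (A * B)).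
  apply: mean => //; last by rewrite -expr2 sqrtAB.
  rewrite le_max; have [AB|/ltW BA] := leP A B; apply/orP; [right|left];
    rewrite -(@ler_pXn2r _ 2) ?nnegrE ?sqrtr_ge0 // sqrtAB expr2.
    by rewrite ler_wpM2r.
  by rewrite ler_wpM2l.
have half : V <= (A + B) * derive1_ext0 tau ((A + B) / 2).
  have := arith (1 / 2).
  have -> : 1 / 2 * A + (1 - 1 / 2) * B = (A + B) / 2 by field.
  have -> : (1 - 1 / 2) * A + 1 / 2 * B = (A + B) / 2 by field.
  have -> : 2 * ((A + B) / 2) = A + B by field.
  by apply; lra.
have halftau : V <= 4 * tau ((A + B) / 2).
  have AB2 : 0 < (A + B) / 2 by lra.
  have := dbl _ AB2; move: half; rewrite derive1_ext0E //; lra.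
split.
  apply: mean => //; first by rewrite lt_max Agt0.
  by have [_|_] := leP A B; rewrite // mulrC.
split=> [b /andP[b0 b1]|].
  have b1' : 0 <= 1 - b by lra.
  have powRD1 (x : R) : 0 < x -> x `^ (1 - b) * x `^ b = x.
    by move=> x0; rewrite -powRD ?(gt_eqF x0) ?implybT // subrK powRr1 // ltW.
  apply: mean.
  - by rewrite mulr_gt0 // powR_gt0.
  - rewrite -[leRHS]powRD1 ?lt_max ?Agt0 //.
    apply: ler_pM; rewrite ?powR_ge0 // ge0_ler_powR //;
      by rewrite ?nnegrE ?le_max ?A0 ?lexx ?orbT.
  - rewrite -[in leLHS](powRD1 A) // -[in leLHS](powRD1 B) //.
    by rewrite le_eqVlt; apply/orP; left; apply/eqP; ring.
split=> //.
split=> //.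
split=> //.
split.
  by have := dbl _ sqrt_gt0; move: geom; rewrite derive1_ext0E //; lra.
split=> //.
have : tau (1 / 2 * A + (1 - 1 / 2) * B)
    <= 1 / 2 * tau A + (1 - 1 / 2) * tau B.
  by apply: transform_convex => //; apply/andP; split; lra.
have -> : 1 / 2 * A + (1 - 1 / 2) * B = (A + B) / 2 by field.
by move: halftau; lra.
Qed.
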